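(* Let $R$ be a left or right Noetherian ring with a derivation $\delta$. Then $$\mathcal{I}_{l}(R((x^{-1};\delta)))=\mathcal{I}_{l,\delta}(R)((x^{-1};\delta)),$$ where $\mathcal{I}_{l,\delta}(R)=\{a \in R : \sum_{j=0}^{\infty}\delta^{j}(a)R \text{ is left T-nilpotent}\}$.
   Context: All rings are associative with identity; ''ideal'' means two-sided ideal, and $I\leq R$ means that $I$ is an ideal of $R$. A derivation of $R$ is an additive map $\delta:R\to R$ with $\delta(ab)=\delta(a)b+a\delta(b)$ for all $a,b\in R$. The pseudo-differential operator ring $R((x^{-1};\delta))$ consists of the formal series $\sum_{i=-\infty}^{n}a_{i}x^{i}$ with $n$ an integer (possibly negative) and $a_i\in R$, with the usual addition and with multiplication determined by $xa=ax+\delta(a)$ and $x^{-1}a=\sum_{i=0}^{\infty}(-1)^{i}\delta^{i}(a)x^{-i-1}$ for all $a\in R$ (equivalently $x^{m}a=\sum_{k\ge 0}\binom{m}{k}\delta^{k}(a)x^{m-k}$ for every integer $m$). For a subset $I\subseteq R$, $I((x^{-1};\delta))$ denotes the subset of $R((x^{-1};\delta))$ of series whose coefficients all lie in $I$. A subset $S$ of a ring is left T-nilpotent if for every countable sequence $s_1,s_2,\ldots\in S$ there is an integer $k\geq 1$ with $s_1s_2\cdots s_k=0$. The left T-nilpotent radideal of a ring $A$ is $\mathcal{I}_{l}(A)=\sum\{I\leq A: I\text{ is left T-nilpotent}\}$. Here $\sum_{j=0}^{\infty}\delta^{j}(a)R$ is the right ideal of $R$ that is the sum of the right ideals $\delta^j(a)R$,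 $j\ge 0$ (its elements are finite sums). *)

(* Defs.v *)
From HB Require Import structures.
From mathcomp Require Import all_boot all_order all_algebra.
From mathcomp Require Import boolp classical_sets fsbigop.
From mathcomp Require Import zify ring.

Set Implicit Arguments.
Unset Strict Implicit.
Unset Printing Implicit Defensive.

Import Order.TTheory GRing.Theory Num.Theory.
Local Open Scope classical_set_scope.
Local Open Scope ring_scope.

Definition left_ideal (A : pzRingType) (I : set A) : Prop :=
  [/\ I 0, forall x y, I x -> I y -> I (x - y) & forall r x, I x -> I (r * x)].

Definition right_ideal (A : pzRingType) (I : set A) : Prop :=
  [/\ I 0, forall x y, I x -> I y -> I (x - y) & forall r x, I x -> I (x * r)].

Definition ideal (A : pzRingType) (I : set A) : Prop :=
  left_ideal I /\ right_ideal I.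

Definition left_noetherian (A : pzRingType) : Prop :=
  forall I : nat -> set A, (forall n, left_ideal (I n)) ->
    (forall n, I n `<=` I n.+1) ->
  exists m, forall n, (m <= n)%N -> I n = I m.

Definition right_noetherian (A : pzRingType) : Prop :=
  forall I : nat -> set A, (forall n, right_ideal (I n)) ->
    (forall n, I n `<=` I n.+1) ->
  exists m, forall n, (m <= n)%N -> I n = I m.

(* The sequence s_1, s_2, ... is indexed from 0 here. *)
Definition left_T_nilpotent (A : pzRingType) (S : set A) : Prop :=
  forall s : nat -> A, (forall i, S (s i)) ->
  exists k, (1 <= k)%N /\ \prod_(i < k) s i = 0.

(* The set of finite sums of elements of members of F; this is the sum of
   the family F when its members are additive subgroups. *)
Definition sum_of (A : pzRingType) (F : set (set A)) : set A :=
  [set x | exists s : seq A,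
     (forall y, y \in s -> exists2 I, F I & I y) /\ x = \sum_(y <- s) y].

Definition left_T_radideal (A : pzRingType) : set A :=
  sum_of [set I : set A | ideal I /\ left_T_nilpotent I].
Arguments left_T_radideal : clear implicits.

Record derivation (R : pzRingType) := Derivation {
  der_fun :> {additive R -> R};
  derM : forall a b, der_fun (a * b) = der_fun a * b + a * der_fun b
}.

Definition delta_right_ideal (R : pzRingType) (delta : derivation R) (a : R) :
    set R :=
  sum_of [set I | exists j : nat, I = [set iter j delta a * r | r in [set: R]]].

Definition left_T_delta_radideal (R : pzRingType) (delta : derivation R) :
    set R :=
  [set a | left_T_nilpotent (delta_right_ideal delta a)].
Arguments left_T_delta_radideal {R} delta.

(* The binomial coefficient m (m - 1) ... (m - k + 1) / k! of an integer m;
   Negz n is - (n + 1), and (-n-1 choose k) = (-1)^k (n+k choose k). *)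
Definition binz (m : int) (k : nat) : int :=
  match m with
  | Posz n => 'C(n, k)%:Z
  | Negz n => (-1) ^+ k * 'C(n + k, k)%:Z
  end.

Definition ffactz (m : int) (k : nat) : int := \prod_(i < k) (m - i%:Z).

Lemma binz_ffactz m k : binz m k * k`!%:Z = ffactz m k.
Proof.
case: m => n; rewrite /binz /ffactz.
  rewrite -PoszM bin_ffact.
  elim: k => [|k IH]; first by rewrite big_ord0 ffactn0.
  rewrite big_ord_recr /= -IH ffactnSr.
  have [le_kn|lt_nk] := leqP k n; first by rewrite PoszM subzn.
  by rewrite ffact_small // mul0r mul0n.
rewrite -mulrA -PoszM bin_ffact.
elim: k => [|k IH]; first by rewrite big_ord0 ffactn0 mulr1.
rewrite big_ord_recr /= -IH addnS ffactSS exprS PoszM NegzE.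
lia.
Qed.

Lemma binz0 m : binz m 0 = 1.
Proof. by have := binz_ffactz m 0; rewrite /ffactz big_ord0 fact0 mulr1. Qed.

Lemma bin0z k : binz 0 k = (k == 0%N)%:Z.
Proof. by case: k. Qed.

Lemma fact_neq0 k : k`!%:Z != 0.
Proof. by have := fact_gt0 k; lia. Qed.

Lemma binzS m k : binz (m + 1) k.+1 = binz m k.+1 + binz m k.
Proof.
apply: (mulIf (fact_neq0 k.+1)); rewrite mulrDl !binz_ffactz.
rewrite factS PoszM mulrCA mulrA -[X in _ = _ + X]mulrA binz_ffactz.
rewrite /ffactz big_ord_recl [in RHS]big_ord_recr /=.
rewrite (eq_bigr (fun i : 'I_k => m - i%:Z)); first ring.
by move=> i _; rewrite /bump /= PoszD; lia.
Qed.

Lemma binzM m k u :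
  binz m (k + u) * 'C(k + u, k)%:Z = binz m k * binz (m - k%:Z) u.
Proof.
apply: (mulIf (fact_neq0 k)); apply: (mulIf (fact_neq0 u)).
have -> : binz m (k + u) * 'C(k + u, k)%:Z * k`!%:Z * u`!%:Z =
          binz m (k + u) * (k + u)`!%:Z.
  rewrite -!mulrA -!PoszM; congr (_ * Posz _).
  by have := bin_fact (leq_addr u k); rewrite addKn.
have -> : binz m k * binz (m - k%:Z) u * k`!%:Z * u`!%:Z =
   (binz m k * k`!%:Z) * (binz (m - k%:Z) u * u`!%:Z) by ring.
rewrite !binz_ffactz /ffactz big_split_ord /=; congr (_ * _).
by apply: eq_bigr => i _; rewrite PoszD; lia.
Qed.

Lemma pascal_uniq (F G : int -> nat -> int) :
    (forall m, F m 0%N = G m 0%N) -> (forall k, F 0 k = G 0 k) ->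
    (forall m k, F (m + 1) k.+1 = F m k.+1 + F m k) ->
    (forall m k, G (m + 1) k.+1 = G m k.+1 + G m k) ->
  forall m k, F m k = G m k.
Proof.
move=> FG0 F0G FS GS.
have FGN (n : nat) k : F (- n%:Z) k = G (- n%:Z) k.
  elim: n k => [|n IHn] k; first by rewrite oppr0.
  elim: k => [|k IHk] //.
  have := FS (- n.+1%:Z) k; have := GS (- n.+1%:Z) k.
  have -> : - n.+1%:Z + 1 = - n%:Z by lia.
  by rewrite IHn IHk; lia.
have FGP (n : nat) k : F n%:Z k = G n%:Z k.
  elim: n k => [|n IHn] [|k] //.
  by rewrite -addn1 PoszD FS GS !IHn.
by case=> n k //; rewrite NegzE.
Qed.

Lemma binz_Vandermonde a b m :
  binz (a + b) m = \sum_(i < m.+1) binz a i * binz b (m - i).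
Proof.
apply: (pascal_uniq (F := fun a m => binz (a + b) m)
          (G := fun a m => \sum_(i < m.+1) binz a i * binz b (m - i))).
- by move=> c; rewrite big_ord1 !binz0.
- move=> k; rewrite add0r big_ord_recl binz0 mul1r subn0 big1 ?addr0 //.
  by move=> i _; rewrite bin0z mul0r.
- by move=> c k; rewrite addrAC binzS.
move=> c k; rewrite big_ord_recl [X in _ = X + _]big_ord_recl !binz0 -addrA.
congr (_ + _); rewrite -big_split /=; apply: eq_bigr => i _.
by rewrite /bump /= add1n binzS mulrDl subSS.
Qed.

Lemma sum_elim (V : zmodType) (B n c : nat) (X : nat -> V) (a : nat) :
    (n < B)%N ->
  \sum_(p < B) X p *+ (a == p) *+ (p + c == n)%N = X a *+ (a + c == n)%N.
Proof.
move=> nB; have [lt_aB|le_Ba] := ltnP a B.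
  rewrite (bigD1 (Ordinal lt_aB)) //= eqxx big1 ?addr0 // => p np.
  have -> : (a == p :> nat) = false.
    by apply/negbTE; apply: contra_neq np => E; apply: val_inj.
  by rewrite mul0rn.
rewrite big1 => [|p _]; first by have -> : (a + c == n)%N = false by lia.
have -> : (a == p :> nat) = false by have := ltn_ord p; lia.
by rewrite mul0rn.
Qed.

Lemma sum_shift (V : zmodType) (B k : nat) (Y : nat -> V) :
    (forall q, (q < k)%N -> Y q = 0) -> (forall q, (B <= q)%N -> Y q = 0) ->
  \sum_(q < B) Y q = \sum_(u < B) Y (k + u)%N.
Proof.
move=> Yk YB; rewrite -!(big_mkord xpredT).
transitivity (\sum_(0 <= q < k + B) Y q).
  rewrite [RHS](@big_cat_nat _ _ _ B) ?leq_addl //=.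
  by rewrite [X in _ + X]big_nat_cond [X in _ + X]big1 ?addr0 // => q /andP[/andP[/YB]].
rewrite (@big_cat_nat _ _ _ k) ?leq_addr //=.
rewrite big_nat_cond big1 ?add0r; last by move=> q /andP[/andP[_ /Yk]].
rewrite -[X in index_iota X]add0n big_addn addKn.
by rewrite big_mkord; apply: eq_bigr => q _ /=; rewrite addnC.
Qed.

Lemma sum_exch3 (V : zmodType) (B : nat) (F : nat -> nat -> nat -> nat -> V) :
  \sum_(p < B) \sum_(i < B) \sum_(j < B) \sum_(k < B) F p i j k =
  \sum_(i < B) \sum_(j < B) \sum_(k < B) \sum_(p < B) F p i j k.
Proof.
rewrite exchange_big; apply: eq_bigr => i _.
by rewrite exchange_big; apply: eq_bigr => j _; rewrite exchange_big.
Qed.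

Lemma sum_push3 (V W : zmodType) (B : nat) (phi : V -> W)
    (F : nat -> nat -> nat -> V) : zmod_morphism phi ->
  phi (\sum_(i < B) \sum_(j < B) \sum_(k < B) F i j k) =
  \sum_(i < B) \sum_(j < B) \sum_(k < B) phi (F i j k).
Proof.
move=> phiB; pose H := GRing.isZmodMorphism.Build V W phi phiB.
pose psi : {additive V -> W} := HB.pack phi H.
rewrite -[phi]/(psi : V -> W) raddf_sum; apply: eq_bigr => i _.
by rewrite raddf_sum; apply: eq_bigr => j _; rewrite raddf_sum.
Qed.

Lemma binz_Vandermonde_box a b (m B : nat) : (m < B)%N ->
  binz (a + b) m =
  \sum_(u < B) \sum_(s < B) binz a u * binz b s *+ (u + s == m)%N.
Proof.
move=> mB; rewrite binz_Vandermonde.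
rewrite (big_ord_widen B (fun i => binz a i * binz b (m - i))) //.
rewrite big_mkcond; apply: eq_bigr => u _; rewrite ltnS.
case: leqP => [le_um|lt_mu].
  have lt_B : (m - u < B)%N by lia.
  rewrite (bigD1 (Ordinal lt_B)) //= subnKC // eqxx big1 ?addr0 // => s ns.
  have -> : (u + s == m)%N = false.
    by apply/negbTE; apply: contra_neq ns => E; apply: val_inj => /=; lia.
  by rewrite mulr0n.
by rewrite big1 // => s _; have -> : (u + s == m)%N = false by lia.
Qed.

(* The formal series \sum_(i <= N) a_i x^i, i : int, with coefficients on the
   left; coef f i is the coefficient a_i of x^i. *)
Record pdo (R : pzRingType) (delta : derivation R) := Pdo {
  coef :> int -> R;
  coef_bounded : exists N : int, forall i, N < i -> coef i = 0
}.

HB.instance Definition _ (R : pzRingType) (delta : derivation R) :=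
  gen_eqMixin (pdo delta).
HB.instance Definition _ (R : pzRingType) (delta : derivation R) :=
  gen_choiceMixin (pdo delta).

Section PdoRing.
Context (R : pzRingType) (delta : derivation R).
Implicit Types (f g h : pdo delta) (a b : R).

Lemma pdoP f g : coef f =1 coef g -> f = g.
Proof.
case: f g => [f fP] [g gP] /= /funext fg; case: _ / fg gP => gP.
by congr Pdo; exact: Prop_irrelevance.
Qed.

Definition bdd (c : int -> R) (N : int) := forall i, N < i -> c i = 0.

Lemma bdd_mono (c : int -> R) (N M : int) : N <= M -> bdd c N -> bdd c M.
Proof. by move=> NM cN i Mi; apply: cN; exact: le_lt_trans Mi. Qed.

Lemma bdd2 f g : exists N, bdd f N /\ bdd g N.
Proof.
have [N fN] := coef_bounded f; have [M gM] := coef_bounded g.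
exists (Num.max N M); split; [apply: bdd_mono fN | apply: bdd_mono gM];
  by rewrite le_max lexx ?orbT.
Qed.

Lemma pdo0_bounded : exists N : int, bdd (fun=> 0) N.
Proof. by exists 0. Qed.
Definition pdo0 : pdo delta := Pdo _ pdo0_bounded.

Lemma pdo_opp_bounded f : exists N, bdd (fun i => - f i) N.
Proof. by have [N fN] := coef_bounded f; exists N => i /fN ->; rewrite oppr0. Qed.
Definition pdo_opp f : pdo delta := Pdo _ (pdo_opp_bounded f).

Lemma pdo_add_bounded f g : exists N, bdd (fun i => f i + g i) N.
Proof.
by have [N [fN gN]] := bdd2 f g; exists N => i Ni; rewrite fN ?gN ?addr0.
Qed.
Definition pdo_add f g : pdo delta := Pdo _ (pdo_add_bounded f g).

Lemma pdo_addA : associative pdo_add.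
Proof. by move=> f g h; apply: pdoP => i; exact: addrA. Qed.
Lemma pdo_addC : commutative pdo_add.
Proof. by move=> f g; apply: pdoP => i; exact: addrC. Qed.
Lemma pdo_add0 : left_id pdo0 pdo_add.
Proof. by move=> f; apply: pdoP => i; exact: add0r. Qed.
Lemma pdo_addN : left_inverse pdo0 pdo_opp pdo_add.
Proof. by move=> f; apply: pdoP => i; exact: addNr. Qed.

HB.instance Definition _ :=
  GRing.isZmodule.Build (pdo delta) pdo_addA pdo_addC pdo_add0 pdo_addN.

Lemma monom_bounded a (m : int) :
  exists N, bdd (fun i => if i == m then a else 0) N.
Proof. by exists m => i mi; rewrite gt_eqF. Qed.
Definition monom a (m : int) : pdo delta := Pdo _ (monom_bounded a m).

(* From (a x^i) (b x^j) = \sum_k (i choose k) a delta^k(b) x^(i+j-k): here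
   p = (i, k), and j = n - i + k. Only finitely many terms are nonzero, see
   mul_coefE. The case f = x^m, g = a is spelled out in coef_XzM. *)
Definition mul_coef f g (n : int) : R :=
  \sum_(p \in [set: int * nat])
    f p.1 * iter p.2 delta (g (n - p.1 + p.2%:Z)) *~ binz p.1 p.2.

Lemma iter_der0 k : iter k delta 0 = 0.
Proof. by elim: k => //= k ->; rewrite raddf0. Qed.

Lemma iter_der_is_zmod k : zmod_morphism (iter k delta).
Proof. by elim: k => // k IH x y; rewrite !iterS IH raddfB. Qed.
HB.instance Definition _ k :=
  GRing.isZmodMorphism.Build R R (iter k delta) (iter_der_is_zmod k).

Lemma bddE (c : int -> R) N i : bdd c N -> c i != 0 -> i <= N.
Proof. by move=> cN; case: leP => // /cN ->; rewrite eqxx. Qed.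

Lemma mul_coef_neq0 f g N M n (p : int * nat) : bdd f N -> bdd g M ->
    f p.1 * iter p.2 delta (g (n - p.1 + p.2%:Z)) *~ binz p.1 p.2 != 0 ->
  p.1 <= N /\ n - p.1 + p.2%:Z <= M.
Proof.
move=> fN gM nz; split.
  by apply: (bddE fN); apply: contra_neq nz => ->; rewrite mul0r mul0rz.
by apply: (bddE gM); apply: contra_neq nz => ->; rewrite raddf0 mulr0 mul0rz.
Qed.

Lemma mul_coef_bdd f g N M : bdd f N -> bdd g M -> bdd (mul_coef f g) (N + M).
Proof.
move=> fN gM n Nn; rewrite /mul_coef fsbig1 // => p _.
by apply/eqP/negP => /negP /(mul_coef_neq0 fN gM) [? ?]; lia.
Qed.

Lemma mul_coef_bounded f g : exists N, bdd (mul_coef f g) N.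
Proof.
have [N [fN gN]] := bdd2 f g; exists (N + N); exact: mul_coef_bdd.
Qed.
Definition pdo_mul f g : pdo delta := Pdo _ (mul_coef_bounded f g).

Lemma mul_coefE f g N M (n B : nat) : bdd f N -> bdd g M -> (n < B)%N ->
  mul_coef f g (N + M - n%:Z) =
  \sum_(i < B) \sum_(j < B) \sum_(k < B)
    (f (N - i%:Z) * iter k delta (g (M - j%:Z)) *~ binz (N - i%:Z) k)
      *+ (i + j + k == n)%N.
Proof.
move=> fN gM nB.
pose r := [seq (N - i%:Z, k) | i <- iota 0 B, k <- iota 0 B] : seq (int * nat).
have ur : uniq r.
  apply: allpairs_uniq; rewrite ?iota_uniq //.
  by move=> [i k] [i' k'] _ _ /= [] /= ? ->; congr pair; lia.
rewrite /mul_coef (fsbigE r) //=; last first.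
  move=> p _ pr; apply/eqP; apply: contraNT pr.
  move=> /(mul_coef_neq0 fN gM) [p1 p2].
  apply/allpairsP; exists (`|N - p.1|%N, p.2); rewrite !mem_iota /=.
  case: p p1 p2 => u v /= p1 p2; split; [lia | lia |].
  by rewrite gez0_abs ?subr_ge0 // subKr.
under eq_bigl do rewrite in_setT.
have mk (F : nat -> R) : \sum_(i <- iota 0 B) F i = \sum_(i < B) F i.
  by rewrite -(big_mkord xpredT) /index_iota subn0.
rewrite big_allpairs_dep mk; apply: eq_bigr => i _; rewrite mk.
rewrite exchange_big /=; apply: eq_bigr => k _.
have [le_n|gt_n] := leqP (i + k) n.
  have lt_B : (n - i - k < B)%N by lia.
  rewrite (bigD1 (Ordinal lt_B)) //= big1 => [|j nj].
    rewrite addr0; have -> : (i + (n - i - k) + k)%N = n by lia.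
    rewrite eqxx mulr1n; suff -> : N + M - n%:Z - (N - i%:Z) + k%:Z =
      M - (n - i - k)%N%:Z by [].
    lia.
  have /negbTE -> // : (i + j + k)%N != n.
  by apply: contra_neq nj => Ejn; apply: val_inj => /=; lia.
rewrite big1 => [|j _]; last by have -> : (i + j + k == n)%N = false by lia.
by rewrite gM ?raddf0 ?mulr0 ?mul0rz //; lia.
Qed.

Lemma iter_derM q a b (B : nat) : (q < B)%N ->
  iter q delta (a * b) =
  \sum_(k < B) (iter k delta a * iter (q - k) delta b) *+ 'C(q, k).
Proof.
elim: q B => [|q IH] B qB.
  by case: B qB => // B _; rewrite big_ord_recl /= big1 ?addr0.
case: B qB => // B; rewrite ltnS => qB /=.
rewrite (IH B) // raddf_sum big_ord_recl /= ?bin0 ?mulr1n ?subn0.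
under eq_bigr do rewrite raddfMn derM mulrnDl.
rewrite big_split /= addrC.
under [X in _ = _ + X]eq_bigr => i _ do rewrite /bump /= add1n binS mulrnDr subSS.
rewrite big_split /= addrA; congr (_ + _).
case: B qB {IH} => // B qB; rewrite big_ord_recl /= ?bin0 ?subn0.
rewrite [in RHS]big_ord_recr /= bin_small // mulr0n addr0; congr (_ + _).
apply: eq_bigr => i _; rewrite /bump /= add1n.
have [lt_iq|le_qi] := ltnP i q; first by rewrite -(subnSK lt_iq).
by rewrite bin_small.
Qed.

Lemma mul_coef_ext f g (c : int -> R) N M : bdd f N -> bdd g M ->
    bdd c (N + M) ->
    (forall n : nat, mul_coef f g (N + M - n%:Z) = c (N + M - n%:Z)) ->
  mul_coef f g =1 c.
Proof.
move=> fN gM cNM E t; have [le_t|lt_t] := leP t (N + M).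
  have -> : t = N + M - `|(N + M - t)%R|%N%:Z by rewrite gez0_abs ?subr_ge0 // subKr.
  exact: E.
by rewrite cNM // (mul_coef_bdd fN gM).
Qed.

Lemma pdo_mulA : associative pdo_mul.
Proof.
move=> f g h; apply: pdoP => t /=.
have [N fN] := coef_bounded f; have [M gM] := coef_bounded g.
have [L hL] := coef_bounded h.
have fgNM : bdd (pdo_mul f g) (N + M) by exact: mul_coef_bdd.
have ghML : bdd (pdo_mul g h) (M + L) by exact: mul_coef_bdd.
move: t; apply: (mul_coef_ext fN ghML).
  by rewrite addrA; exact: mul_coef_bdd.
move=> n; rewrite [in RHS]addrA.
have nB : (n < n.+1)%N by [].
rewrite (mul_coefE fN ghML nB) (mul_coefE fgNM hL nB).
set B := n.+1 in nB *.
pose T i j l k m : R :=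
  f (N - i%:Z) * iter k delta (g (M - j%:Z)) * iter m delta (h (L - l%:Z)).
transitivity (\sum_(i < B) \sum_(j < B) \sum_(k < B) \sum_(l < B)
  \sum_(u < B) \sum_(s < B)
  T i j l k (u + s)%N *~ (binz (N - i%:Z) k * (binz (N - i%:Z - k%:Z) u *
    binz (M - j%:Z) s)) *+ (u + s + (i + j + k + l) == n)%N).
  apply: eq_bigr => i _.
  transitivity (\sum_(q < B) \sum_(p < B) \sum_(j < B) \sum_(l < B)
    \sum_(s < B) \sum_(k < B)
      T i j l k (q - k + s)%N *~ (binz (N - i%:Z) q * 'C(q, k)%:Z *
        binz (M - j%:Z) s) *+ (j + l + s == p)%N *+ (p + (i + q) == n)%N).
    rewrite exchange_big; apply: eq_bigr => q _; apply: eq_bigr => p _ /=.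
    have pB : (p < B)%N by [].
    rewrite (mul_coefE gM hL pB).
    pose phi x := f (N - i%:Z) * iter q delta x *~ binz (N - i%:Z) q
      *+ (i + p + q == n)%N.
    have phiB : zmod_morphism phi.
      by move=> x y; rewrite /phi raddfB mulrBr mulrzBl mulrnBl.
    rewrite -/(phi _) (@sum_push3 _ _ _ phi (fun j l s => (g (M - j%:Z) *
      iter s delta (h (L - l%:Z)) *~ binz (M - j%:Z) s) *+ (j + l + s == p)%N)) //.
    apply: eq_bigr => j _; apply: eq_bigr => l _; apply: eq_bigr => s _.
    rewrite /phi raddfMn raddfMz /= (@iter_derM q _ _ B) //.
    rewrite mulrz_suml -sumrMnl mulr_sumr mulrz_suml -sumrMnl.
    apply: eq_bigr => k _; rewrite -iterD.
    rewrite (pmulrn _ 'C(_, _)) ?mulrnAr !mulrzAr mulrA -/(T i j l k _).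
    rewrite (_ : (i + p + q) = (p + (i + q)))%N; last by lia.
    case: (j + l + s == p)%N; rewrite ?mulr1n ?mulr0n ?mul0rz ?mulr0 ?mulr0z ?mul0rn -?mulrzA //.
    by congr (_ *~ _ *+ _); ring.
  transitivity (\sum_(q < B) \sum_(j < B) \sum_(l < B) \sum_(s < B) \sum_(k < B)
      T i j l k (q - k + s)%N *~ (binz (N - i%:Z) q * 'C(q, k)%:Z *
        binz (M - j%:Z) s) *+ (j + l + s + (i + q) == n)%N).
    apply: eq_bigr => q _.
    rewrite (sum_exch3 _ (fun p j l s => \sum_(k < B)
      T i j l k (q - k + s)%N *~ (binz (N - i%:Z) q * 'C(q, k)%:Z *
        binz (M - j%:Z) s) *+ (j + l + s == p)%N *+ (p + (i + q) == n)%N)).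
    apply: eq_bigr => j _; apply: eq_bigr => l _; apply: eq_bigr => s _.
    rewrite exchange_big; apply: eq_bigr => k _ /=.
    exact: (sum_elim _ (fun=> _)).
  rewrite (sum_exch3 _ (fun q j l s => \sum_(k < B)
      T i j l k (q - k + s)%N *~ (binz (N - i%:Z) q * 'C(q, k)%:Z *
        binz (M - j%:Z) s) *+ (j + l + s + (i + q) == n)%N)).
  apply: eq_bigr => j _; rewrite [RHS]exchange_big; apply: eq_bigr => l _ /=.
  transitivity (\sum_(k < B) \sum_(s < B) \sum_(q < B)
      T i j l k (q - k + s)%N *~ (binz (N - i%:Z) q * 'C(q, k)%:Z *
        binz (M - j%:Z) s) *+ (j + l + s + (i + q) == n)%N).
    rewrite [RHS]exchange_big; apply: eq_bigr => s _ /=; exact: exchange_big.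
  apply: eq_bigr => k _; rewrite [RHS]exchange_big; apply: eq_bigr => s _ /=.
  rewrite (@sum_shift _ B k (fun q => 
      T i j l k (q - k + s)%N *~ (binz (N - i%:Z) q * 'C(q, k)%:Z *
        binz (M - j%:Z) s) *+ (j + l + s + (i + q) == n)%N)).
  - apply: eq_bigr => u _; rewrite binzM addKn -mulrA.
    by congr (_ *+ nat_of_bool (_ == _)); lia.
  - by move=> q qk; rewrite bin_small // mulr0 mul0r mulr0z mul0rn.
  - by move=> q Bq; have -> : (j + l + s + (i + q) == n)%N = false by lia.
symmetry.
transitivity (\sum_(p < B) \sum_(l < B) \sum_(m < B) \sum_(i < B)
    \sum_(j < B) \sum_(k < B)
    T i j l k m *~ (binz (N - i%:Z) k * binz (N + M - p%:Z) m)
      *+ (i + j + k == p)%N *+ (p + (l + m) == n)%N).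
  apply: eq_bigr => p _; apply: eq_bigr => l _; apply: eq_bigr => m _.
  have pB : (p < B)%N by [].
  rewrite /= (mul_coefE fN gM pB).
  pose phi x := x * iter m delta (h (L - l%:Z)) *~ binz (N + M - p%:Z) m
    *+ (p + l + m == n)%N.
  have phiB : zmod_morphism phi.
    by move=> x y; rewrite /phi mulrBl mulrzBl mulrnBl.
  rewrite -/(phi _) (@sum_push3 _ _ _ phi (fun i j k => (f (N - i%:Z) *
    iter k delta (g (M - j%:Z)) *~ binz (N - i%:Z) k) *+ (i + j + k == p)%N)) //.
  apply: eq_bigr => i _; apply: eq_bigr => j _; apply: eq_bigr => k _.
  rewrite /phi mulrnAl mulrzAl -/(T i j l k m).
  rewrite (_ : (p + l + m) = (p + (l + m)))%N; last by lia.
  by case: (i + j + k == p)%N; rewrite ?mulr1n ?mulr0n ?mul0rz ?mulr0 ?mulr0z ?mul0rn -?mulrzA.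
transitivity (\sum_(l < B) \sum_(m < B) \sum_(i < B) \sum_(j < B) \sum_(k < B)
    T i j l k m *~ (binz (N - i%:Z) k * binz (N + M - (i + j + k)%N%:Z) m)
      *+ (i + j + k + (l + m) == n)%N).
  rewrite (sum_exch3 _ (fun p l m i => \sum_(j < B) \sum_(k < B)
    T i j l k m *~ (binz (N - i%:Z) k * binz (N + M - p%:Z) m)
      *+ (i + j + k == p)%N *+ (p + (l + m) == n)%N)).
  apply: eq_bigr => l _; apply: eq_bigr => m _; apply: eq_bigr => i _.
  rewrite exchange_big; apply: eq_bigr => j _ /=.
  rewrite exchange_big; apply: eq_bigr => k _ /=.
  exact: (sum_elim _ (fun p =>
    T i j l k m *~ (binz (N - i%:Z) k * binz (N + M - p%:Z) m))).
rewrite (eq_bigr (fun l : 'I_B => \sum_(i < B) \sum_(j < B) \sum_(k < B) \sum_(m < B)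
    T i j l k m *~ (binz (N - i%:Z) k * binz (N + M - (i + j + k)%N%:Z) m)
      *+ (i + j + k + (l + m) == n)%N)); last first.
  by move=> l _; rewrite (sum_exch3 _ (fun m i j k =>
    T i j l k m *~ (binz (N - i%:Z) k * binz (N + M - (i + j + k)%N%:Z) m)
      *+ (i + j + k + (l + m) == n)%N)).
rewrite (sum_exch3 _ (fun l i j k => \sum_(m < B)
    T i j l k m *~ (binz (N - i%:Z) k * binz (N + M - (i + j + k)%N%:Z) m)
      *+ (i + j + k + (l + m) == n)%N)).
apply: eq_bigr => i _; apply: eq_bigr => j _; apply: eq_bigr => k _.
apply: eq_bigr => l _.
transitivity (\sum_(m < B) \sum_(u < B) \sum_(s < B)
  T i j l k m *~ (binz (N - i%:Z) k * (binz (N - i%:Z - k%:Z) u *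
    binz (M - j%:Z) s)) *+ (u + s == m)%N *+ (m + (i + j + k + l) == n)%N).
  apply: eq_bigr => m _.
  have -> : N + M - (i + j + k)%N%:Z = (N - i%:Z - k%:Z) + (M - j%:Z).
    by rewrite !PoszD; ring.
  rewrite (@binz_Vandermonde_box _ _ m B) // mulr_sumr mulrz_sumr -sumrMnl.
  apply: eq_bigr => u _; rewrite mulr_sumr mulrz_sumr -sumrMnl.
  apply: eq_bigr => s _.
  rewrite (_ : i + j + k + (l + m) = m + (i + j + k + l))%N; last by lia.
  by case: (u + s == m)%N; rewrite ?mulr1n ?mulr0n ?mulr0 ?mulr0z ?mul0rn.
rewrite exchange_big; apply: eq_bigr => u _ /=.
rewrite exchange_big; apply: eq_bigr => s _ /=.
exact: (sum_elim _ (fun m => T i j l k m *~ (binz (N - i%:Z) k *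
  (binz (N - i%:Z - k%:Z) u * binz (M - j%:Z) s)))).
Qed.

Definition pdo_one : pdo delta := monom 1 0.

Lemma der1 : delta 1 = 0.
Proof.
have := derM delta 1 1; rewrite !mul1r mulr1 => /eqP.
by rewrite -subr_eq subrr eq_sym => /eqP.
Qed.

Lemma iter_der1 k : iter k delta 1 = if k == 0%N then 1 else 0.
Proof. by case: k => //= k; elim: k => [|k IH] /=; rewrite ?der1 ?IH ?raddf0. Qed.

Lemma pdo_mul1 : left_id pdo_one pdo_mul.
Proof.
move=> g; apply: pdoP => n /=; rewrite /mul_coef (fsbigE [:: (0, 0%N)]) //=.
  by rewrite big_mkcond big_seq1 in_setT /= subr0 addr0 mul1r.
move=> [i k] _; rewrite inE xpair_eqE /=.
case: eqP => [->|_] /=; last by rewrite mul0r mul0rz.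
by case: k => // k _; rewrite bin0z.
Qed.

Lemma pdo_mulr1 : right_id pdo_one pdo_mul.
Proof.
move=> f; apply: pdoP => n /=; rewrite /mul_coef (fsbigE [:: (n, 0%N)]) //=.
  by rewrite big_mkcond big_seq1 in_setT /= subrr addr0 eqxx mulr1 binz0.
move=> [i k] _; rewrite inE xpair_eqE /=.
case: ifP => [/eqP n0|_ _]; last by rewrite raddf0 mulr0 mul0rz.
rewrite iter_der1; case: k n0 => [|k] n0; last by rewrite mulr0 mul0rz.
by rewrite andbT => /eqP ni; lia.
Qed.

Lemma pdo_mulDl : left_distributive pdo_mul +%R.
Proof.
move=> f g h; apply: pdoP => t /=.
have [N [fN gN]] := bdd2 f g; have [L hL] := coef_bounded h.
have fgN : bdd (f + g) N by move=> i Ni; rewrite /= fN ?gN ?addr0.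
move: t; apply: (mul_coef_ext fgN hL).
  by move=> i Ni; rewrite (mul_coef_bdd fN hL) ?(mul_coef_bdd gN hL) ?addr0.
move=> n; rewrite (mul_coefE fgN hL (ltnSn n)) (mul_coefE fN hL (ltnSn n)).
rewrite (mul_coefE gN hL (ltnSn n)).
do 3 (rewrite -big_split /=; apply: eq_bigr => ? _).
by rewrite mulrDl mulrzDl mulrnDl.
Qed.

Lemma pdo_mulDr : right_distributive pdo_mul +%R.
Proof.
move=> h f g; apply: pdoP => t /=.
have [N [fN gN]] := bdd2 f g; have [L hL] := coef_bounded h.
have fgN : bdd (f + g) N by move=> i Ni; rewrite /= fN ?gN ?addr0.
move: t; apply: (mul_coef_ext hL fgN).
  by move=> i Ni; rewrite (mul_coef_bdd hL fN) ?(mul_coef_bdd hL gN) ?addr0.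
move=> n; rewrite (mul_coefE hL fgN (ltnSn n)) (mul_coefE hL fN (ltnSn n)).
rewrite (mul_coefE hL gN (ltnSn n)).
do 3 (rewrite -big_split /=; apply: eq_bigr => ? _).
by rewrite raddfD mulrDr mulrzDl mulrnDl.
Qed.

HB.instance Definition _ := GRing.Zmodule_isPzRing.Build (pdo delta)
  pdo_mulA pdo_mul1 pdo_mulr1 pdo_mulDl pdo_mulDr.

(* x^m a = \sum_k (m choose k) delta^k(a) x^(m - k) *)
Lemma coef_XzM (m : int) a n :
  (monom 1 m * monom a 0) n =
  if n <= m then iter `|m - n|%N delta a *~ binz m `|m - n|%N else 0.
Proof.
rewrite /GRing.mul /= /mul_coef; case: leP => [le_nm|lt_mn].
  rewrite (fsbigE [:: (m, `|m - n|%N)]) //=.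
    rewrite big_mkcond big_seq1 in_setT /= eqxx mul1r ifT //.
    by rewrite gez0_abs ?subr_ge0 //; apply/eqP; ring.
  move=> [i k] _; rewrite inE xpair_eqE /=.
  case: eqP => [->|_] /=; last by rewrite mul0r mul0rz.
  case: ifP => [/eqP|_ _]; last by rewrite raddf0 mulr0 mul0rz.
  by move=> E /eqP; lia.
rewrite fsbig1 // => -[i k] _ /=; case: eqP => [->|_]; last by rewrite mul0r mul0rz.
case: ifP => [/eqP|_]; last by rewrite raddf0 mulr0 mul0rz.
by lia.
Qed.

End PdoRing.

Definition pdo_sub (R : pzRingType) (delta : derivation R) (I : set R) :
    set (pdo delta) :=
  [set f | forall i : int, I (coef f i)].
Arguments pdo_sub {R} delta I.

(* Main.v *)
Require Import Defs.
From mathcomp Require Import all_boot all_order all_algebra.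
From mathcomp Require Import boolp classical_sets fsbigop.
From mathcomp Require Import zify.

(** Write A for the pseudo-differential operator ring. Everything rests on one
    nilpotent ideal P of R, chosen maximal among the nilpotent ideals by the
    chain condition. Maximality makes P semiprime: if a R a lies in P, then P
    together with a generates an ideal whose square is in P, hence a nilpotent
    ideal. Levitzki's theorem, in Utumi's form, then puts every a such that a R
    is nil into P ([nil_right_ideal_sub_semiprime]). If the right ideal
    generated by the derivatives of a is left T-nilpotent, it is in particular
    nil, so it lies in P; conversely every subset of P is T-nilpotent. Hence
    the right-hand radical of the theorem is the coefficient set

      D = {a : every delta^j(a) lies in P},

    which is visibly a delta-stable nilpotent ideal
    ([left_T_delta_radideal_core]).

    One inclusion follows because D((x^-1)) is then a nilpotent ideal of A
    ([pdo_sub_nilpotent]), so that it is one of the summands of the radideal.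

    For the other one, let I be a left T-nilpotent ideal of A. The constant
    terms of its members of degree at most 0 form a right ideal L of R. The
    identity x f - f x = sum_i delta(f_i) x^i makes L delta-stable, and L is
    T-nilpotent because constant terms multiply in degree at most 0; so L lies
    in D. Multiplying by a power of x moves the leading term of any member of I
    to degree 0, so all leading coefficients lie in D. To reach the remaining
    coefficients, replace I by I + D((x^-1)), which is still T-nilpotent
    because D((x^-1)) is nilpotent: now a leading term can be subtracted
    without leaving the ideal, and the next coefficient becomes the leading one
    ([T_nilpotent_ideal_sub_pdo_sub]). *)

Set Implicit Arguments.
Unset Strict Implicit.
Unset Printing Implicit Defensive.

Import Order.TTheory GRing.Theory Num.Theory.
Local Open Scope classical_set_scope.
Local Open Scope ring_scope.

(** * Additive subgroups and ideals *)

Definition zmod_closed_set (A : pzRingType) (M : set A) : Prop :=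
  M 0 /\ forall x y, M x -> M y -> M (x - y).

Section ZmodClosedSet.
Context (A : pzRingType) (M : set A).
Hypothesis MZ : zmod_closed_set M.

Lemma zmod_closedN x : M x -> M (- x).
Proof. by case: MZ => M0 MB /(MB _ _ M0); rewrite sub0r. Qed.

Lemma zmod_closedD x y : M x -> M y -> M (x + y).
Proof. by move=> Mx /zmod_closedN My; rewrite -[y]opprK; apply: MZ.2. Qed.

Lemma zmod_closed_muln x n : M x -> M (x *+ n).
Proof.
move=> Mx; elim: n => [|n IH]; first exact: MZ.1.
by rewrite mulrS; exact: zmod_closedD.
Qed.

Lemma zmod_closed_mulz x z : M x -> M (x *~ z).
Proof.
move=> Mx; case: z => n; first exact: zmod_closed_muln.
by apply: zmod_closedN; exact: zmod_closed_muln.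
Qed.

End ZmodClosedSet.

Section IdealTheory.
Context (A : pzRingType) (I : set A).
Hypothesis idI : ideal I.

Lemma ideal0 : I 0.
Proof. by case: idI => -[]. Qed.

Lemma idealB x y : I x -> I y -> I (x - y).
Proof. by case: idI => -[_ IB _] _; exact: IB. Qed.

Lemma idealMl r x : I x -> I (r * x).
Proof. by case: idI => -[_ _ IM] _; exact: IM. Qed.

Lemma idealMr r x : I x -> I (x * r).
Proof. by case: idI => _ [_ _ IM]; exact: IM. Qed.

Lemma ideal_zmod_closed : zmod_closed_set I.
Proof. by split; [exact: ideal0|exact: idealB]. Qed.

End IdealTheory.

(** * Nilpotency and T-nilpotency *)

Definition nilpotent_elt (A : pzRingType) (a : A) : Prop :=
  exists k, a ^+ k = 0.

Lemma nilpotent_eltC (A : pzRingType) (x y : A) :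
  nilpotent_elt (x * y) -> nilpotent_elt (y * x).
Proof.
case=> k xyk; exists k.+1.
have E n : (y * x) ^+ n * y = y * (x * y) ^+ n.
  elim: n => [|n IH]; first by rewrite !expr0 mul1r mulr1.
  by rewrite exprS -mulrA IH exprS !mulrA.
by rewrite exprSr mulrA E xyk mulr0 mul0r.
Qed.

Definition nilpotent_set (A : pzRingType) (S : set A) (m : nat) : Prop :=
  forall s : seq A, size s = m -> (forall x, x \in s -> S x) ->
  \prod_(x <- s) x = 0.

(** T-nilpotency survives an extension by a nilpotent set: a sequence in S can
    be cut into consecutive blocks whose products lie in N, and m blocks
    multiply to zero. *)
Lemma T_nilpotent_extension (A : pzRingType) (N S : set A) (m : nat) :
    nilpotent_set N m ->
    (forall s : nat -> A, (forall i, S (s i)) ->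
      exists k, N (\prod_(i < k) s i)) ->
  left_T_nilpotent S.
Proof.
move=> nilN SN s Ss.
have blocks n : forall t : nat -> A, (forall i, S (t i)) ->
    exists k (u : seq A), [/\ size u = n, forall x, x \in u -> N x &
      \prod_(i < k) t i = \prod_(x <- u) x].
  elim: n => [|n IH] t St.
    by exists 0%N, [::]; split=> //; rewrite big_ord0 big_nil.
  have [k Nk] := SN t St.
  have [l [u [su Nu eu]]] := IH (fun i => t (k + i)%N) (fun i => St _).
  exists (k + l)%N, (\prod_(i < k) t i :: u); split=> /=; first by rewrite su.
    by move=> x; rewrite inE => /orP[/eqP -> //|]; exact: Nu.
  by rewrite big_split_ord big_cons /= -eu.
have [k [u [su Nu eu]]] := blocks m s Ss.
(* Here k may be 0, when 1 = 0; one more factor makes the length positive. *)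
by exists k.+1; split=> //; rewrite big_ord_recr /= eu nilN // mul0r.
Qed.

Lemma nilpotent_T_nilpotent (A : pzRingType) (S : set A) (m : nat) :
  nilpotent_set S m -> left_T_nilpotent S.
Proof.
move=> nilS; apply: (T_nilpotent_extension nilS) => s Ss.
by exists 1%N; rewrite big_ord1.
Qed.

Lemma T_nilpotent_sub (A : pzRingType) (S T : set A) :
  S `<=` T -> left_T_nilpotent T -> left_T_nilpotent S.
Proof. by move=> ST nilT s Ss; apply: nilT => i; apply: ST. Qed.

(** * Chain conditions and semiprime ideals *)

(** Without a maximal member, dependent choice would build a strictly ascending
    chain. The class C is kept abstract because the lemma serves for one-sided
    as well as for two-sided ideals. *)
Lemma acc_maximal (T : Type) (C F : set (set T)) :
    (forall I : nat -> set T, (forall n, C (I n)) ->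
       (forall n, I n `<=` I n.+1) ->
     exists m, forall n, (m <= n)%N -> I n = I m) ->
    F `<=` C -> F !=set0 ->
  exists2 K, F K & forall L, F L -> K `<=` L -> L `<=` K.
Proof.
move=> acc FC [K0 FK0]; apply: contrapT => nomax.
have next (K : {K | F K}) : exists L : {K | F K},
    sval K `<=` sval L /\ ~ (sval L `<=` sval K).
  case: K => K FK /=; apply: contrapT => nL; apply: nomax; exists K => // L FL KL.
  by apply: contrapT => nLK; apply: nL; exists (exist _ L FL).
have [g gP] := choice next.
pose I n := iter n g (exist _ K0 FK0).
have [m mP] := acc (fun n => sval (I n)) (fun n => FC _ (svalP (I n)))
  (fun n => (gP (I n)).1).
by case: (gP (I m)) => _; apply; rewrite -(mP m.+1 (leqnSn m)).
Qed.

Lemma acc_ideals (A : pzRingType) :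
    left_noetherian A \/ right_noetherian A ->
  forall I : nat -> set A, (forall n, ideal (I n)) ->
    (forall n, I n `<=` I n.+1) ->
  exists m, forall n, (m <= n)%N -> I n = I m.
Proof. by case=> noeth I idI; apply: noeth => n; case: (idI n). Qed.

Definition semiprime_set (A : pzRingType) (P : set A) : Prop :=
  forall a, (forall x, P (a * x * a)) -> P a.

Section IdealAdjoin.
Context (A : pzRingType) (P : set A) (a : A).
Hypothesis idP : ideal P.

(** Generation is encoded as an intersection of ideals, so that membership is
    used by exhibiting one suitable ideal K. *)
Definition ideal_adjoin : set A :=
  [set x | forall K, ideal K -> P `<=` K -> K a -> K x].

Lemma ideal_adjoin_ideal : ideal ideal_adjoin.
Proof.
split; split=> [K idK PK Ka|x y xP yP K idK PK Ka|r x xP K idK PK Ka].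
- exact: ideal0.
- by apply: (idealB idK); [apply: xP|apply: yP].
- by apply: (idealMl idK); apply: xP.
- exact: ideal0.
- by apply: (idealB idK); [apply: xP|apply: yP].
- by apply: (idealMr idK); apply: xP.
Qed.

Lemma sub_ideal_adjoin : P `<=` ideal_adjoin.
Proof. by move=> x Px K _ PK _; exact: PK. Qed.

Lemma ideal_adjoin_gen : ideal_adjoin a.
Proof. by move=> K. Qed.

(** Modulo P the generated ideal is R a R plus integer multiples of a and its
    one-sided multiples, and any product of two such terms contains a R a.
    Spelling out these terms is avoided by annihilators: the z killed modulo P
    by a R on the left form an ideal that contains P and a, hence the whole
    generated ideal; then the z with z R y in P are treated in the same way. *)
Lemma ideal_adjoin_sq : (forall x, P (a * x * a)) ->
  forall x y, ideal_adjoin x -> ideal_adjoin y -> P (x * y).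
Proof.
move=> aPa x y Ix Iy; have [[P0 PB PMl] [_ _ PMr]] := idP.
have aIy r z : ideal_adjoin z -> P (a * r * z).
  move=> Iz; suff: [set z | forall r, P (a * r * z)] z by move=> /(_ r).
  apply: Iz => [|u Pu t|]; [|exact: PMl|by []].
  split; split=> [t|u v uP vP t|t u uP w] /=.
  - by rewrite mulr0.
  - by rewrite mulrBr; apply: PB.
  - by rewrite mulrA -[_ * w * t]mulrA; apply: uP.
  - by rewrite mulr0.
  - by rewrite mulrBr; apply: PB.
  - by rewrite mulrA; apply: PMr.
have : [set z | forall r, P (z * r * y)] x.
  apply: Ix => [|u Pu t|t]; [|by apply/PMr/PMr|exact: aIy].
  split; split=> [t|u v uP vP t|t u uP w] /=.
  - by rewrite !mul0r.
  - by rewrite !mulrBl; apply: PB.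
  - by rewrite -!mulrA; apply: PMl; rewrite mulrA.
  - by rewrite !mul0r.
  - by rewrite !mulrBl; apply: PB.
  - by rewrite -[u * t * w]mulrA; apply: uP.
by move=> /(_ 1); rewrite mulr1.
Qed.

End IdealAdjoin.

Lemma nilpotent_set_sqrt (A : pzRingType) (P Q : set A) (m : nat) :
    nilpotent_set P m -> (forall x y, Q x -> Q y -> P (x * y)) ->
  nilpotent_set Q m.*2.
Proof.
move=> nilP QP s ss Qs.
suff [t [st Pt ->]] : exists t : seq A, [/\ size t = m,
    forall x, x \in t -> P x & \prod_(x <- s) x = \prod_(x <- t) x].
  exact: nilP.
elim: m s ss Qs {nilP} => [|m IH] [|x [|y s]] //= ss Qs; first by exists [::].
have [t [st Pt e]] : exists t : seq A, [/\ size t = m,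
    forall x, x \in t -> P x & \prod_(x <- s) x = \prod_(x <- t) x].
  apply: IH; first by case: ss.
  by move=> z zs; apply: Qs; rewrite !inE zs !orbT.
exists (x * y :: t); split=> /=; first by rewrite st.
  move=> z; rewrite inE => /orP[/eqP -> |]; last exact: Pt.
  by apply: QP; apply: Qs; rewrite !inE eqxx ?orbT.
by rewrite !big_cons e mulrA.
Qed.

(** A maximal nilpotent ideal P is semiprime: when a R a lies in P, adjoining a
    to P gives an ideal whose square lies in P, which is nilpotent and so is
    not larger than P. *)
Lemma exists_nilpotent_semiprime (A : pzRingType) :
    left_noetherian A \/ right_noetherian A ->
  exists P : set A,
    [/\ ideal P, exists m, nilpotent_set P m & semiprime_set P].
Proof.
move=> noethA.
have [||P [idP [m nilP]] maxP] := @acc_maximal A (@ideal A)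
  [set I | ideal I /\ exists m, nilpotent_set I m] (acc_ideals noethA).
- by move=> I [].
- exists [set 0]; split.
    split; split=> //= [x y -> -> | r x ->];
      by rewrite ?subrr ?mulr0 ?mul0r.
  exists 1%N => -[|x [|]] //= _ /(_ x (mem_head _ _)) ->.
  by rewrite big_seq1.
exists P; split=> //; first by exists m.
move=> a aPa; apply: (maxP (ideal_adjoin P a)).
- split; first exact: ideal_adjoin_ideal.
  exists m.*2; apply: nilpotent_set_sqrt nilP _; exact: ideal_adjoin_sq.
- exact: sub_ideal_adjoin.
- exact: ideal_adjoin_gen.
Qed.

(** Utumi's argument, carried out modulo P. Among the b outside P such that b R
    is nil, take one whose right annihilator modulo P is maximal. For x in R
    let k be least with (b x)^k.+1 b in P and put c = (b x)^k b. Then c is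
    again outside P with c R nil, and its annihilator contains that of b, so
    the two agree. It contains x b, whence b x b lies in P; as x is arbitrary
    and P is semiprime, b lies in P. *)
Lemma nil_right_ideal_sub_semiprime_right (A : pzRingType) (P : set A) (a : A) :
    right_noetherian A -> ideal P -> semiprime_set P ->
    (forall x, nilpotent_elt (a * x)) ->
  P a.
Proof.
move=> noethA idP sprP nila; apply: contrapT => nPa.
have [[P0 PB PMl] [_ _ PMr]] := idP.
pose ann (b : A) : set A := [set x | P (b * x)].
have [||_ [b [nilb nPb] ->] maxb] := @acc_maximal A (@right_ideal A)
  [set K | exists2 b, (forall x, nilpotent_elt (b * x)) /\ ~ P b & K = ann b]
  noethA.
- move=> _ [b _ ->]; split=> [|x y Px Py|r x Px]; rewrite /ann /=.
  + by rewrite mulr0.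
  + by rewrite mulrBr; apply: PB.
  + by rewrite mulrA; apply: PMr.
- by exists (ann a), a.
apply: (nPb); apply: sprP => x.
have exk : exists k, `[< P ((b * x) ^+ k * b) >].
  by have [k bxk] := nilb x; exists k; apply/asboolP; rewrite bxk mul0r.
case: (ex_minnP exk) => -[|k] /asboolP Pk mink.
  by rewrite expr0 mul1r in Pk.
pose c := (b * x) ^+ k * b.
have nPc : ~ P c by move=> /asboolP /mink; rewrite ltnn.
have : ann c `<=` ann b.
  apply: maxb; last by move=> y Py; rewrite /ann /= -mulrA; apply: PMl.
  exists c => //; split=> // y; apply: nilpotent_eltC; rewrite mulrA.
  by apply: nilpotent_eltC; exact: nilb.
move=> /(_ (x * b)); rewrite /ann /= -[b * x * b]mulrA; apply.
by rewrite /c !mulrA -[_ * b * x]mulrA -exprSr.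
Qed.

(** Nilpotency of x a and of a x are equivalent, so the hypothesis on a is
    symmetric and the left Noetherian case is the right Noetherian one in the
    converse ring. *)
Lemma nil_right_ideal_sub_semiprime (A : pzRingType) (P : set A) (a : A) :
    left_noetherian A \/ right_noetherian A -> ideal P -> semiprime_set P ->
    (forall x, nilpotent_elt (a * x)) ->
  P a.
Proof.
case=> noethA idP sprP nila; last exact: nil_right_ideal_sub_semiprime_right.
apply: (@nil_right_ideal_sub_semiprime_right A^c P a) => //.
- by case: idP.
- by move=> b bPb; apply: sprP => x; rewrite -mulrA; exact: bPb.
- move=> x; have [k xak] := nilpotent_eltC (nila x); exists k.
  by rewrite -[RHS]xak; exact: revrX.
Qed.

Lemma zmod_closed_fsbig (A : pzRingType) (M : set A) (I : choiceType)
    (D : set I) (F : I -> A) :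
  zmod_closed_set M -> (forall i, M (F i)) -> M (\sum_(i \in D) F i).
Proof.
move=> MZ MF; apply: big_ind => // [|x y]; first exact: MZ.1.
exact: zmod_closedD.
Qed.

(** * Series with coefficients in a prescribed set *)

Section PdoSub.
Context (R : pzRingType) (delta : derivation R).
Implicit Types (f g h : pdo delta) (D K L M : set R).

Lemma pdo_sub_mul K L M f g : zmod_closed_set M ->
    (forall a b k, K a -> L b -> M (a * iter k delta b)) ->
  pdo_sub delta K f -> pdo_sub delta L g -> pdo_sub delta M (f * g).
Proof.
move=> MZ KLM Kf Lg n; apply: zmod_closed_fsbig => // p.
by apply: zmod_closed_mulz => //; exact: KLM.
Qed.

Definition der_stable D : Prop := forall a, D a -> D (delta a).

Lemma der_stable_iter D k a : der_stable D -> D a -> D (iter k delta a).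
Proof. by move=> Ddelta Da; elim: k => //= k; exact: Ddelta. Qed.

Lemma pdo_sub_ideal D : ideal D -> der_stable D -> ideal (pdo_sub delta D).
Proof.
move=> idD Ddelta; have DZ := ideal_zmod_closed idD.
have D0 : pdo_sub delta D 0 by move=> i; exact: ideal0.
have DB f g : pdo_sub delta D f -> pdo_sub delta D g -> pdo_sub delta D (f - g).
  by move=> Df Dg i; exact: (idealB idD).
split; split=> // h f Df.
- apply: (@pdo_sub_mul setT D) => // a b k _ Db.
  by apply: idealMl => //; exact: der_stable_iter.
- by apply: (@pdo_sub_mul D setT) => // a b k Da _; exact: idealMr.
Qed.

(** Coefficients of products are finite sums of c * delta^k(b). Let ann n be the
    left annihilator of the products of n elements of D. As D is delta-stable,
    multiplying a series over ann n.+1 by a series over D on the right gives a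
    series over ann n. The series 1 is over ann m, hence a product of m series
    over D is over ann 0, which is zero. *)
Lemma pdo_sub_nilpotent D m : der_stable D -> nilpotent_set D m ->
  nilpotent_set (pdo_sub delta D) m.
Proof.
move=> Ddelta nilD.
pose ann n : set R := [set c | forall s : seq R, size s = n ->
  (forall x, x \in s -> D x) -> c * \prod_(x <- s) x = 0].
have annZ n : zmod_closed_set (ann n).
  split=> [s _ _|c d cs ds s ss Ds]; first by rewrite mul0r.
  by rewrite mulrBl cs // ds // subrr.
have prod_ann n (s : seq (pdo delta)) h : size s = n ->
    (forall f, f \in s -> pdo_sub delta D f) ->
    pdo_sub delta (ann n) h -> pdo_sub delta (ann 0%N) (h * \prod_(f <- s) f).
  elim: s n h => [|f s IH] [|n] h //=; first by rewrite big_nil mulr1.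
  move=> [ss] Ds annh; rewrite big_cons mulrA; apply: (IH n) => //.
    by move=> g gs; apply: Ds; rewrite inE gs orbT.
  have Df : pdo_sub delta D f by apply: Ds; exact: mem_head.
  apply: (pdo_sub_mul (annZ n) _ annh Df) => a b k anna Db t st Dt.
  have := anna (iter k delta b :: t); rewrite big_cons mulrA; apply.
    by rewrite /= st.
  move=> x; rewrite inE => /orP[/eqP ->|]; last exact: Dt.
  exact: der_stable_iter.
move=> s ss Ds; apply: pdoP => i.
have ann1 : pdo_sub delta (ann m) 1.
  by move=> j t st Dt; rewrite nilD // mulr0.
by have := prod_ann m s 1 ss Ds ann1 i [::]; rewrite mul1r big_nil mulr1; apply.
Qed.

(** * Leading coefficients *)

Lemma bdd_mul f g (N M : int) : bdd f N -> bdd g M -> bdd (f * g) (N + M).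
Proof. exact: mul_coef_bdd. Qed.

Lemma lead_coef_mul f g (N M : int) : bdd f N -> bdd g M ->
  (f * g) (N + M) = f N * g M.
Proof.
move=> fN gM; have := mul_coefE fN gM (ltnSn 0).
by rewrite !big_ord1 /= !subr0 binz0 !mulr1n.
Qed.

Lemma bdd_monom a m : bdd (monom delta a m) m.
Proof. by move=> i mi; rewrite /= gt_eqF. Qed.

Lemma monom_id a m : monom delta a m m = a.
Proof. by rewrite /= eqxx. Qed.

Lemma coef_mulX f n : (f * monom delta 1 1) n = f (n - 1).
Proof.
rewrite /GRing.mul /= /mul_coef (fsbigE [:: (n - 1, 0%N)]) //=.
  rewrite big_mkcond big_seq1 in_setT /= binz0 mulr1z.
  by rewrite ifT ?mulr1 //; lia.
move=> [i k] _; rewrite inE xpair_eqE /=.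
case: ifP => [/eqP n0|_ _]; last by rewrite raddf0 mulr0 mul0rz.
rewrite iter_der1; case: k n0 => [|k] n0; last by rewrite mulr0 mul0rz.
by rewrite andbT => /eqP ni; lia.
Qed.

Lemma coef_Xmul f n : (monom delta 1 1 * f) n = f (n - 1) + delta (f n).
Proof.
rewrite /GRing.mul /= /mul_coef (fsbigE [:: (1, 0%N); (1, 1%N)]) //=.
  rewrite !big_mkcond big_cons big_seq1 !in_setT /= !mul1r addr0.
  by rewrite subrK.
move=> [i k] _; rewrite !inE !xpair_eqE /=.
case: eqP => [->|_] /=; last by rewrite mul0r mul0rz.
by case: k => [|[|k]] //= _; rewrite /binz bin_small.
Qed.

(** The commutator with x is delta applied coefficientwise: this is what carries
    delta-stability from ideals of series to their leading coefficients. *)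
Lemma coef_commX f n :
  (monom delta 1 1 * f - f * monom delta 1 1) n = delta (f n).
Proof.
transitivity ((monom delta 1 1 * f) n - (f * monom delta 1 1) n) => //.
by rewrite coef_Xmul coef_mulX addrAC subrr add0r.
Qed.

(** Only degree at most 0 is considered: multiplication by a power of x brings
    every series there, and degree 0 makes the set closed under subtraction
    and makes leading coefficients multiply without any shift. *)
Definition leading_coefs (I : set (pdo delta)) : set R :=
  [set a | exists f, [/\ I f, bdd f 0 & f 0 = a]].

Section LeadingCoefs.
Variable I : set (pdo delta).
Hypothesis idI : ideal I.

Lemma leading_coefs_right_ideal : right_ideal (leading_coefs I).
Proof.
split.
- by exists 0; split=> //; exact: ideal0.
- move=> _ _ [f [If f0 <-]] [g [Ig g0 <-]]; exists (f - g); split=> //.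
    exact: idealB.
  by move=> i i0; rewrite /= f0 ?g0 ?subr0.
- move=> r _ [f [If f0 <-]]; exists (f * monom delta r 0); split.
  + exact: idealMr.
  + by have := bdd_mul f0 (@bdd_monom r 0); rewrite addr0.
  + by have := lead_coef_mul f0 (@bdd_monom r 0); rewrite addr0 monom_id.
Qed.

Lemma leading_coefs_der_stable : der_stable (leading_coefs I).
Proof.
move=> _ [f [If f0 <-]].
exists (monom delta 1 1 * f - f * monom delta 1 1); split.
- by apply: idealB => //; [exact: idealMl|exact: idealMr].
- by move=> i i0; rewrite coef_commX f0 ?raddf0.
- exact: coef_commX.
Qed.

Lemma leading_coefs_T_nilpotent :
  left_T_nilpotent I -> left_T_nilpotent (leading_coefs I).
Proof.
move=> nilI s Ls; have [g gP] := choice Ls.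
have [k [k1 g0]] := nilI g (fun i => let: And3 Ig _ _ := gP i in Ig).
exists k; split=> //.
suff [_ <-] : bdd (\prod_(i < k) g i) 0 /\ (\prod_(i < k) g i) 0 = \prod_(i < k) s i.
  by rewrite g0.
elim: k {k1 g0} => [|k [bk ek]].
  by rewrite !big_ord0; split; [exact: bdd_monom|exact: monom_id].
have [_ bg eg] := gP k.
rewrite !big_ord_recr /=; split; first by rewrite -[0]addr0; exact: bdd_mul.
by have := lead_coef_mul bk bg; rewrite addr0 ek eg.
Qed.

End LeadingCoefs.

(** * The delta-radideal of the coefficient ring *)

Lemma sum_of_min (A : pzRingType) (F : set (set A)) (M : set A) :
  zmod_closed_set M -> (forall I, F I -> I `<=` M) -> sum_of F `<=` M.
Proof.
move=> MZ FM x [s [sF ->]]; rewrite big_seq.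
apply: (big_ind M) => [|y z|y /sF[I FI Iy]]; first exact: MZ.1.
  exact: zmod_closedD.
exact: FM Iy.
Qed.

Lemma delta_right_ideal_min (L : set R) a :
  right_ideal L -> der_stable L -> L a -> delta_right_ideal delta a `<=` L.
Proof.
move=> [L0 LB LM] Ldelta La; apply: sum_of_min => // _ [j ->] _ [r _ <-].
by apply: LM; exact: der_stable_iter.
Qed.

Lemma sub_left_T_delta_radideal (L : set R) :
  right_ideal L -> der_stable L -> left_T_nilpotent L ->
  L `<=` left_T_delta_radideal delta.
Proof.
move=> idL Ldelta nilL a La; apply: T_nilpotent_sub nilL.
exact: delta_right_ideal_min.
Qed.

Lemma delta_right_ideal_mem a j r :
  delta_right_ideal delta a (iter j delta a * r).
Proof.
exists [:: iter j delta a * r]; split; last by rewrite big_seq1.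
move=> y; rewrite inE => /eqP ->.
by exists [set iter j delta a * r | r in [set: R]]; [exists j|exists r].
Qed.

(** The largest delta-stable part of P. *)
Definition der_core (P : set R) : set R :=
  [set a | forall j, P (iter j delta a)].

Lemma der_core_stable P : der_stable (der_core P).
Proof. by move=> a Pa j; rewrite -iterSr; exact: Pa. Qed.

Lemma der_core_sub P : der_core P `<=` P.
Proof. by move=> a /(_ 0%N). Qed.

Lemma der_core_ideal P : ideal P -> ideal (der_core P).
Proof.
move=> idP; have PZ := ideal_zmod_closed idP.
have P0 : der_core P 0 by move=> j; rewrite iter_der0; exact: ideal0.
have PB a b : der_core P a -> der_core P b -> der_core P (a - b).
  by move=> Pa Pb j; rewrite iter_der_is_zmod; exact: (idealB idP).
split; split=> // r a Pa j.
- elim: j r a Pa => [|j IH] r a Pa; first exact: (idealMl idP _ (Pa 0%N)).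
  rewrite iterSr derM raddfD; apply: zmod_closedD => //; apply: IH => //.
  exact: der_core_stable.
- elim: j r a Pa => [|j IH] r a Pa; first exact: (idealMr idP _ (Pa 0%N)).
  rewrite iterSr derM raddfD; apply: zmod_closedD => //; apply: IH => //.
  exact: der_core_stable.
Qed.

End PdoSub.

(** The chain condition enters the theorem only here: T-nilpotency of the right
    ideal generated by the derivatives of a is used through constant sequences
    alone, that is as nilness, and P absorbs nil right ideals. *)
Lemma left_T_delta_radideal_core (R : pzRingType) (delta : derivation R) :
    left_noetherian R \/ right_noetherian R ->
  exists P : set R, [/\ ideal P, exists m, nilpotent_set P m &
    left_T_delta_radideal delta = der_core delta P].
Proof.
move=> noethR.
have [P [idP [m nilP] sprP]] := exists_nilpotent_semiprime noethR.
exists P; split=> //; first by exists m.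
apply/seteqP; split=> a.
  move=> nila j; apply: nil_right_ideal_sub_semiprime => // x.
  have [k [_ ek]] := nila (fun=> iter j delta a * x)
    (fun=> delta_right_ideal_mem delta a j x).
  by exists k; rewrite -ek prodr_const card_ord.
apply: sub_left_T_delta_radideal; first by case: (der_core_ideal delta idP).
  exact: der_core_stable.
apply: T_nilpotent_sub (nilpotent_T_nilpotent nilP); exact: der_core_sub.
Qed.

(** * T-nilpotent ideals of series *)

(** J = I + D((x^-1)) is a T-nilpotent ideal, so its leading coefficients lie in
    D; since J contains every series over D, a leading term can be removed
    inside J, and the coefficients of f are reached one after the other. *)
Lemma T_nilpotent_ideal_sub_pdo_sub (R : pzRingType) (delta : derivation R)
    (D : set R) (I : set (pdo delta)) (m : nat) :
    ideal D -> der_stable delta D -> nilpotent_set D m ->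
    left_T_delta_radideal delta `<=` D ->
    ideal I -> left_T_nilpotent I ->
  I `<=` pdo_sub delta D.
Proof.
move=> idD Ddelta nilD radD idI nilI.
have idN := pdo_sub_ideal idD Ddelta.
have NZ := ideal_zmod_closed idN.
pose J : set (pdo delta) := [set f | exists2 g, I g & pdo_sub delta D (f - g)].
have idJ : ideal J.
  split; split=> [|f1 f2 [g1 I1 N1] [g2 I2 N2]|r f [g Ig Ng]].
  - by exists 0; [exact: ideal0|rewrite subr0; exact: (ideal0 idN)].
  - exists (g1 - g2); first exact: idealB.
    rewrite (_ : _ - _ = (f1 - g1) - (f2 - g2)); first exact: (idealB idN).
    by rewrite !opprD !opprK addrACA.
  - by exists (r * g); [exact: idealMl|rewrite -mulrBr; exact: (idealMl idN)].
  - by exists 0; [exact: ideal0|rewrite subr0; exact: (ideal0 idN)].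
  - exists (g1 - g2); first exact: idealB.
    rewrite (_ : _ - _ = (f1 - g1) - (f2 - g2)); first exact: (idealB idN).
    by rewrite !opprD !opprK addrACA.
  - by exists (g * r); [exact: idealMr|rewrite -mulrBl; exact: (idealMr idN)].
have nilJ : left_T_nilpotent J.
  apply: (T_nilpotent_extension (pdo_sub_nilpotent Ddelta nilD)) => s Js.
  have [g gP] := choice (fun i => let: ex_intro2 g Ig Ng := Js i in
    ex_intro (fun g => I g /\ pdo_sub delta D (s i - g)) g (conj Ig Ng)).
  have [k [_ gk]] := nilI g (fun i => (gP i).1).
  exists k; rewrite -[X in pdo_sub _ _ X]subr0 -gk.
  elim: k {gk} => [|k IH]; first by rewrite !big_ord0 subrr; exact: (ideal0 idN).
  rewrite !big_ord_recr /=.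
  (* With S, G the products of the first k factors and s, g the next ones:
     S s - G g = (S - G) s + G (s - g). *)
  rewrite -(subrK (\prod_(i < k) g i * s k) (_ * s k)) -addrA -mulrBl -mulrBr.
  by apply: (zmod_closedD NZ); [exact: (idealMr idN)|apply: (idealMl idN); exact: (gP k).2].
have lead f (N : int) : J f -> bdd f N -> D (f N).
  move=> Jf fN; apply/radD/(sub_left_T_delta_radideal _ _ _).
  - exact: (leading_coefs_right_ideal idJ).
  - exact: leading_coefs_der_stable.
  - exact: leading_coefs_T_nilpotent.
  exists (f * monom delta 1 (- N)).
  have := bdd_mul fN (@bdd_monom _ delta 1 (- N)).
  have := lead_coef_mul fN (@bdd_monom _ delta 1 (- N)).
  by rewrite subrr monom_id mulr1; split=> //; exact: idealMr.
have sub_monom a (N : int) : D a -> J (monom delta a N).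
  move=> Da; exists 0; first exact: ideal0.
  by rewrite subr0 => i /=; case: ifP => // _; exact: ideal0.
have strip k : forall f (N : int), J f -> bdd f N -> D (f (N - k%:Z)).
  elim: k => [|k IH] f N Jf fN; first by rewrite subr0; exact: lead.
  have Df : D (f N) by exact: lead.
  have := IH (f - monom delta (f N) N) (N - 1).
  have -> : N - 1 - k%:Z = N - k.+1%:Z by lia.
  rewrite /= (_ : (N - k.+1%:Z == N) = false) ?subr0; last by lia.
  apply; first by apply: idealB => //; exact: sub_monom.
  move=> i Ni /=; case: eqP => [->|]; first by rewrite subrr.
  by move=> iN; rewrite fN ?subr0 //; lia.
move=> f If i; have Jf : J f by exists f; rewrite ?subrr //; exact: (ideal0 idN).
have [N fN] := coef_bounded f; have [iN|/fN ->] := leP i N; last exact: ideal0.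
have := strip `|N - i|%N f N Jf fN.
by rewrite gez0_abs ?subr_ge0 // subKr.
Qed.

Theorem theorem2p9 (R : pzRingType) (delta : derivation R)
    (noethR : left_noetherian R \/ right_noetherian R) :
  left_T_radideal (pdo delta) = pdo_sub delta (left_T_delta_radideal delta).
Proof.
have [P [idP [m nilP] eD]] := left_T_delta_radideal_core delta noethR.
have idD := der_core_ideal delta idP.
have Ddelta := @der_core_stable R delta P.
have nilD : nilpotent_set (der_core delta P) m.
  by move=> s ss Ds; apply: nilP => // x /Ds; exact: der_core_sub.
have idN := pdo_sub_ideal idD Ddelta.
rewrite eD; apply/seteqP; split=> [|f Df].
  apply: sum_of_min; first exact: ideal_zmod_closed.
  move=> I [idI nilI]; apply: (@T_nilpotent_ideal_sub_pdo_sub _ _ _ _ m) => //.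
  by rewrite eD.
exists [:: f]; split; last by rewrite big_seq1.
move=> g; rewrite inE => /eqP ->; exists (pdo_sub delta (der_core delta P)) => //.
split=> //; exact: nilpotent_T_nilpotent (pdo_sub_nilpotent Ddelta nilD).
Qed.
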